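(* Let $n\ge3$. The diagrams $\alpha_n,\omega_n,\pi_n\in\mathcal{E}_n$ satisfy the following extremal properties among Enriques diagrams of blow-up complexity $n$: (1) $\alpha_n$ is the unique diagram in $\mathcal{E}_n$ with minimal (initial) multiplicity, which is equal to $2$, and (the unique diagram) with minimal Milnor number, which is equal to $2n-4$. (2) $\omega_n$ and $\pi_n$ are the only diagrams in $\mathcal{E}_n$ with maximal (initial) multiplicity, which is equal to the $n$-th Fibonacci number $F_n$. (3) $\omega_n$ is the unique diagram in $\mathcal{E}_n$ with maximal Milnor number, which is equal to $(F_{n+1}-1)(F_n-1)$.
   Context: Fibonacci numbers: $F_0=0$, $F_1=1$, $F_{n+1}=F_n+F_{n-1}$ for $n\ge1$. A plane branch is a reduced irreducible germ $(C,O)$ of complex analytic curve on a germ $(\mathcal{S},O)$ of smooth complex analytic surface. A model over $(\mathcal{S},O)$ is a composition of finitely many blow-ups of points above $O$. An infinitely near point of $O$ is a point lying over $O$ on some model, two such points being identified when the bimeromorphic map between the models is an isomorphism near them. $E(P)$ denotes the exceptional curve created by blowing up $P$, and also its strict transforms. $Q$ is proximate to $P$ if $Q\in E(P)$. A point $\neq O$ is free if it is proximate to exactly one point, and satellite if it is proximate to two. The minimal embedded resolution of $(C,O)$ is obtained by repeatedly blowing up the unique point where the total transform of $C$ is not a normal crossing. Let $P_0=O,P_1,\dots,P_{n-1}$ be the points blown up, in order; $n$ is the blow-up complexity of $C$ ($n=0$ if $C$ is smooth, $n\ge3$ otherwise). Enriques diagram of $C$ (for $n\ge3$): the path graph with vertices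 $v_0,\dots,v_{n-1}$ (with $v_i$ corresponding to $P_i$) and edges $e_i=[v_{i-1}v_i]$, $1\le i\le n-1$, where each edge is decorated as curved or straight and each vertex as breaking or neutral, as follows. A straight path is a path of straight edges all of whose interior vertices are neutral; it is maximal if adding an adjacent edge never gives a straight path. (1) $e_i$ is curved iff $P_i$ is free. (2) If $P_{i+1},\dots,P_k$ are all the points of the sequence proximate to $P_i$ and $k\ge i+2$, then $[v_{i+1}v_k]$ is a maximal straight path, and if moreover $e_{i+1}$ is straight then $v_{i+1}$ is a breaking vertex. All other vertices are neutral. $\mathcal{E}_n$ is the set of isomorphism classes of Enriques diagrams of plane branches of blow-up complexity $n$. Always $e_1$ is curved, $e_{n-1}$ is straight and $v_0,v_1,v_{n-1}$ are neutral; a decoration with these properties is an Enriques diagram of complexity $n$ iff both edges adjacent to every breaking vertex are straight. Multiplicity function: $m_i$ is the multiplicity at $P_i$ of the strict transform of $C$ passing through $P_i$. It depends only on the diagram: $m_{n-1}=1$ and, for $i\le n-2$, $m_i=\sum_{k=i+1}^{j}m_k$ if there is a maximal straight path $[v_{i+1}v_j]$ with $j>i+1$, and $m_i=m_{i+1}$ otherwise. The (initial) multiplicity of a diagram is $m_0$, the multiplicity of $C$ at $O$. The Milnor number of a diagram is the Milnor number of a branch having that diagram; it equals $\mu=\sum_{i=0}^{n-1}m_i(m_i-1)$. Special diagrams in $\mathcal{E}_n$: - $\alpha_n$: all the edges $e_2,\dots,e_{n-2}$ are curved (hence $v_2,\dots,v_{n-2}$ are neutral). - $\omega_n$: all the vertices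 $v_2,\dots,v_{n-2}$ are breaking (hence $e_2,\dots,e_{n-2}$ are straight). - $\pi_n$: identical to $\omega_n$ except that $v_2$ is neutral. (For $n=3$ these three diagrams coincide.) *)

(* Defs.v *)
From mathcomp Require Import all_boot.

Set Implicit Arguments.
Unset Strict Implicit.
Unset Printing Implicit Defensive.

Fixpoint fib (n : nat) : nat :=
  if n is n'.+1 then (if n' is n''.+1 then fib n' + fib n'' else 1) else 0.

(* A decoration of the path graph with vertices v_0, ..., v_{n-1} and edges
   e_i = [v_{i-1} v_i] for 1 <= i <= n-1. The first tuple lists the edges
   e_1, ..., e_{n-1} (true = straight, false = curved), the second one the
   vertices v_0, ..., v_{n-1} (true = breaking, false = neutral).
   In an Enriques diagram with n >= 3, e_1 is curved and e_{n-1} is straight,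
   so no isomorphism of decorated path graphs reverses the path: isomorphism
   classes of diagrams are the same thing as decorations. *)
Definition decoration (n : nat) : Type :=
  ((n.-1).-tuple bool * n.-tuple bool)%type.

Section Decoration.
Variables (n : nat) (D : decoration n).

(* The edge e_i is stored at position i.-1; there is no edge e_i for i = 0 or
   i >= n. *)
Definition straight (i : nat) : bool := (0 < i) && nth false D.1 i.-1.

Definition breaking (i : nat) : bool := nth false D.2 i.

(* [v_a v_b] is a straight path: the edges e_{a+1}, ..., e_b are straight and
   the interior vertices v_{a+1}, ..., v_{b-1} are neutral. *)
Definition straight_path (a b : nat) : bool :=
  [&& a < b < n, all straight (index_iota a.+1 b.+1)
    & all (fun i => ~~ breaking i) (index_iota a.+1 b)].

(* For b = n-1 there is no edge to add on the right, and [straight_path a b.+1]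
   is false. *)
Definition maximal_straight_path (a b : nat) : bool :=
  [&& straight_path a b,
      (0 < a) ==> ~~ straight_path a.-1 b
    & ~~ straight_path a b.+1].

(* The multiplicity m_i at P_i of the strict transform of a branch with this
   diagram (proximity equality), by descending recursion on
   i; the first argument only bounds the recursion depth, see [multE]. *)
Fixpoint mult_rec (fuel i : nat) : nat :=
  if fuel is fuel'.+1 then
    if i.+1 < n then
      if [pick j : 'I_n | (i.+1 < j) && maximal_straight_path i.+1 j] is Some j
      then \sum_(i.+1 <= k < j.+1) mult_rec fuel' k
      else mult_rec fuel' i.+1
    else 1
  else 0.

Definition mult (i : nat) : nat := mult_rec n i.

Definition initial_mult : nat := mult 0.

(* The Milnor number of a plane branch with multiplicities m_i at the points
   P_0, ..., P_{n-1} blown up in its minimal embedded resolution is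
   \sum_i m_i (m_i - 1); it depends only on the diagram. *)
Definition milnor : nat := \sum_(i < n) mult i * (mult i - 1).

Lemma mult_rec_fuel p q i :
  i < n -> n <= i + p -> n <= i + q -> mult_rec p i = mult_rec q i.
Proof.
elim: p q i => [|p IHp] [|q] i ltin; rewrite ?addn0 ?addnS => lep leq //=.
- by move: lep; rewrite leqNgt ltin.
- by move: leq; rewrite leqNgt ltin.
case: ltnP => // ltSin; case: pickP => [j _|_]; last by apply: IHp.
rewrite !big_nat; apply: eq_bigr => k /andP[lik lkj].
apply: IHp; first by apply: leq_ltn_trans (ltn_ord j); rewrite -ltnS.
- by apply: leq_trans lep _; rewrite -addSn leq_add2r.
- by apply: leq_trans leq _; rewrite -addSn leq_add2r.
Qed.

Lemma multE i : i < n ->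
  mult i =
    if i.+1 < n then
      if [pick j : 'I_n | (i.+1 < j) && maximal_straight_path i.+1 j] is Some j
      then \sum_(i.+1 <= k < j.+1) mult k
      else mult i.+1
    else 1.
Proof.
move=> ltin; rewrite /mult (@mult_rec_fuel n n.+1) ?leq_addl //.
by rewrite addnS ltnW // ltnS leq_addl.
Qed.

End Decoration.

(* The set E_n, for n >= 3, of the Enriques diagrams of plane branches of
   blow-up complexity n, through their combinatorial characterization among
   decorations. *)
Definition enriques (n : nat) : {set decoration n} :=
  [set D : decoration n |
    [&& ~~ straight D 1, straight D n.-1,
        ~~ breaking D 0, ~~ breaking D 1, ~~ breaking D n.-1
      & [forall i : 'I_n,
          breaking D i ==> (straight D i && straight D i.+1)]]].

(* The decoration with straight edges the e_i such that s i, and breaking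
   vertices the v_i such that b i. *)
Definition decorate (n : nat) (s b : pred nat) : decoration n :=
  ([tuple s i.+1 | i < n.-1], [tuple b i | i < n]).

Definition alpha_diagram (n : nat) : decoration n :=
  decorate n (fun i => i == n.-1) pred0.

Definition omega_diagram (n : nat) : decoration n :=
  decorate n (fun i => 1 < i) (fun i => 1 < i < n.-1).

Definition pi_diagram (n : nat) : decoration n :=
  decorate n (fun i => 1 < i) (fun i => 2 < i < n.-1).

Definition minimizes (n : nat) (f : decoration n -> nat) (D : decoration n) :=
  D \in enriques n /\ forall D', D' \in enriques n -> f D <= f D'.

Definition maximizes (n : nat) (f : decoration n -> nat) (D : decoration n) :=
  D \in enriques n /\ forall D', D' \in enriques n -> f D' <= f D.

(* Main.v *)
(** Let s_i (called [run]) be m_i plus the multiplicities at the later vertices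
    of the straight path through e_{i+1}, and s_i = m_i if e_{i+1} is curved.
    Then (m_i, s_i) is obtained from (m, s) = (m_{i+1}, s_{i+1}) by one of three
    moves: (s, s) if e_{i+1} is curved, (m, m+s) if v_{i+1} is interior to a
    straight path, and (s, s+m) otherwise. One starts from (1, 1) at i = n-1 and
    gets (1, 2) at i = n-2; moreover m_0 = s_1 because e_1 is curved.
    By induction m_i <= F_{n-i} and s_i <= F_{n-i+1}. From i = n-3 on, both
    equalities survive only the third move, while the second one preserves just
    the maximality of s_i: this is the exceptional diagram pi_n.
    Dually, s_i >= 2 for i <= n-2, and the sum of the m_k (m_k - 1) for k >= i
    plus s_i (s_i - 1) grows by at least 2 at each of these moves, with equality
    only as long as all of them are of the first kind. *)

Require Import Defs.
From mathcomp Require Import all_boot zify.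

Set Implicit Arguments.
Unset Strict Implicit.
Unset Printing Implicit Defensive.

(** * Descending induction and Fibonacci arithmetic *)

Lemma down_ind (n : nat) (P : nat -> Prop) :
  (0 < n -> P n.-1) -> (forall i, i.+1 < n -> P i.+1 -> P i) -> forall i, i < n -> P i.
Proof.
move=> Pn IH i ltin; have [d] := ubnP (n - i); elim: d i ltin => // d IHd i ltin led.
have [ltin'|leni] := ltnP i.+1 n; first by apply: IH => //; apply: IHd => //; lia.
by have -> : i = n.-1; [lia | apply: Pn; lia].
Qed.

Lemma fibSS n : fib n.+2 = fib n.+1 + fib n.
Proof. by []. Qed.

Lemma fib_gt0 n : 0 < fib n.+1.
Proof. by elim: n => // n IHn; rewrite fibSS addn_gt0 IHn. Qed.

(** Induction on n, from F_{n+1}(F_{n+1}-1) + (F_{n+1}-1)(F_n-1) = (F_{n+1}-1)(F_{n+2}-1). *)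
Lemma sum_fib_pronic n :
  \sum_(i < n) fib (n - i) * (fib (n - i) - 1) = (fib n.+1 - 1) * (fib n - 1).
Proof.
elim: n => [|n IHn]; first by rewrite big_ord0.
rewrite big_ord_recl; under eq_bigr do rewrite lift0 subSS.
rewrite IHn subn0 fibSS; have := fib_gt0 n.
(* As F_0 = 0, the truncated difference F_0 - 1 is treated apart. *)
case: n {IHn} => [//|n]; have := fib_gt0 n; nia.
Qed.

Lemma leqif_pronic x y :
  0 < x -> x <= y -> x * (x - 1) <= y * (y - 1) ?= iff (x == y).
Proof.
move=> x_gt0 lexy; split; first by nia.
by apply/eqP/eqP => [|-> //]; nia.
Qed.

(** * Straight paths and the recursion for (m_i, s_i) *)

Section Diagram.
Variables (n : nat) (D : decoration n).

Let m := mult D.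

Lemma straight_lt i : straight D i -> i < n.
Proof.
case/andP=> i_gt0; case: (ltnP i.-1 n.-1) => [|le]; first by lia.
by rewrite nth_default ?size_tuple.
Qed.

Lemma straight_pathS a b :
  straight_path D a b =
  [&& a < b, straight D a.+1
    & (b == a.+1) || ~~ breaking D a.+1 && straight_path D a.+1 b].
Proof.
rewrite /straight_path; have [ltab|] //= := ltnP a b.
have iotaS x y : x < y -> index_iota x y = x :: index_iota x.+1 y.
  by move=> ltxy; rewrite /index_iota -(subnSK ltxy).
rewrite (iotaS a.+1) //=.
have [->|neb] /= := eqVneq b a.+1.
  by rewrite /index_iota !subnn /= !andbT; apply/andb_idl => /straight_lt.
have ltaSb : a.+1 < b by lia.
rewrite ltaSb (iotaS a.+1 b) //=.
by case: (straight D a.+1); case: (breaking D a.+1); case: (b < n); rewrite ?andbF ?andbT.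
Qed.

Lemma straight_path_prefix a b c :
  straight_path D a b -> a < c <= b -> straight_path D a c.
Proof.
case/and3P=> ltabn /allP sE /allP bE ltacb; apply/and3P; split; first by lia.
- by apply/allP=> k; rewrite mem_index_iota => kE; apply: sE; rewrite mem_index_iota; lia.
- by apply/allP=> k; rewrite mem_index_iota => kE; apply: bE; rewrite mem_index_iota; lia.
Qed.

Definition inner (i : nat) : bool :=
  [&& straight D i, straight D i.+1 & ~~ breaking D i].

Definition run (i : nat) : nat :=
  m i + \sum_(i.+1 <= k < n | straight_path D i k) m k.

(** Shortening a straight path keeps it straight, so the indices summed in [run] fill the whole
    interval up to j, as in the proximity equality. *)
Lemma run_maximal i j :
  straight_path D i j -> ~~ straight_path D i j.+1 ->
  run i = \sum_(i <= k < j.+1) m k.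
Proof.
move=> pij npijS; have /and3P[/andP[ltij ltjn] _ _] := pij.
rewrite big_ltn 1?ltnW // /run (big_cat_nat (n := j.+1)) //=; last exact: ltnW.
rewrite [X in _ + (_ + X)]big1_seq ?addn0.
  congr (_ + _); rewrite big_nat_cond [RHS]big_nat_cond; apply: eq_bigl => k.
  by rewrite andbT; apply/andb_idr=> kE; apply: straight_path_prefix pij _.
move=> k; rewrite mem_index_iota => /andP[pik kE].
by case/negP: npijS; apply: straight_path_prefix pik _; lia.
Qed.

(** A straight path from v_i beyond v_{i+1} is e_{i+1} followed by a straight path from v_{i+1},
    which requires v_{i+1} to be [inner]. *)
Lemma runS i : i.+1 < n ->
  run i = m i + (if straight D i.+1 then
                   if inner i.+1 then run i.+1 else m i.+1
                 else 0).
Proof.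
move=> ltSin; congr (_ + _); rewrite big_ltn_cond //.
have pS : straight_path D i i.+1 = straight D i.+1.
  by rewrite straight_pathS leqnn eqxx andbT.
have tailE : \sum_(i.+2 <= k < n | straight_path D i k) m k =
    if inner i.+1 then \sum_(i.+2 <= k < n | straight_path D i.+1 k) m k else 0.
  case: ifPn => [/and3P[s1 s2 nb]|ninn].
    rewrite big_nat_cond [RHS]big_nat_cond; apply: eq_bigl => k.
    apply/andb_id2l=> /andP[ltik _]; rewrite straight_pathS s1 nb /=.
    have /negPf-> : k != i.+1 by lia.
    by rewrite (ltnW ltik).
  rewrite big1_seq // => k; rewrite mem_index_iota straight_pathS.
  case/andP=> /and3P[_ s1 /orP[/eqP->|/andP[nb]]]; first by lia.
  rewrite straight_pathS => /and3P[_ s2 _].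
  by case/negP: ninn; rewrite /inner s1 s2 nb.
rewrite pS tailE /run /inner; case: (straight D i.+1) => //=.
by case: ifP; rewrite ?addn0.
Qed.

(** If v_{i+1} is [inner], every straight path starting there extends to the left, so none is
    maximal. Otherwise the longest one is maximal and sums to s_{i+1}; if there is none, s_{i+1} =
    m_{i+1}. *)
Lemma multS i : i.+1 < n -> m i = if inner i.+1 then m i.+1 else run i.+1.
Proof.
move=> ltSin; rewrite /m (Defs.multE _ (ltnW ltSin)) ltSin -/m.
have left_ext j : straight_path D i.+1 j ->
    straight_path D i j = straight D i.+1 && ~~ breaking D i.+1.
  move=> pj; have /and3P[/andP[ltij _] _ _] := pj.
  rewrite straight_pathS pj (ltnW ltij) andbT /=.
  by have -> : (j == i.+1) = false by lia.
have innerE j : straight_path D i.+1 j -> inner i.+1 = straight_path D i j.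
  move=> pj; rewrite left_ext //; move: pj; rewrite straight_pathS /inner.
  by case/and3P=> _ -> _.
case: pickP => [j /and3P[_ pj /andP[/= npij npjS]]|nomax].
  by rewrite (innerE _ pj) (negPf npij) -run_maximal.
case: ifPn => // ninn.
have [s2|ns2] := boolP (straight D i.+2); last first.
  rewrite /run big1 ?addn0 // => k.
  by rewrite straight_pathS (negPf ns2) andbF.
have p1 : straight_path D i.+1 i.+2 by rewrite straight_pathS leqnn s2 eqxx.
have exP : exists k, straight_path D i.+1 k by exists i.+2.
have boundP k : straight_path D i.+1 k -> k <= n.
  by case/and3P=> /andP[_ /ltnW].
case: (ex_maxnP exP boundP) => j pj maxj.
have /and3P[/andP[ltij ltjn] _ _] := pj.
have := nomax (Ordinal ltjn); rewrite /= ltij /maximal_straight_path pj /=.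
rewrite -(innerE _ pj) ninn /=.
by case: (boolP (straight_path D i.+1 j.+1)) => // /maxj; rewrite ltnn.
Qed.

Lemma mult_last : 0 < n -> m n.-1 = 1.
Proof. by move=> n_gt0; rewrite /m Defs.multE prednK ?ltnn. Qed.

Lemma run_last : 0 < n -> run n.-1 = 1.
Proof. by move=> n_gt0; rewrite /run prednK // big_geq // addn0 mult_last. Qed.

(** * Fibonacci upper bounds *)

Lemma mult_run_bounds i : i < n ->
  [/\ 0 < m i, m i <= run i, m i <= fib (n - i) & run i <= fib (n - i).+1].
Proof.
move: i; apply: down_ind => [n_gt0|i ltSin [m_gt0 lemr mF rF]].
  by rewrite mult_last ?run_last //; have -> : n - n.-1 = 1 by lia.
have eqF : fib (n - i).+1 = fib (n - i.+1).+1 + fib (n - i.+1).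
  by rewrite -fibSS (subnSK (ltnW ltSin)).
have eqF' : fib (n - i) = fib (n - i.+1).+1 by rewrite (subnSK (ltnW ltSin)).
(* When v_{i+1} is [inner], m_i = m_{i+1} is bounded through m_{i+1} <= s_{i+1}. *)
rewrite runS // multS //; case: ifP; case: ifP => *; split; lia.
Qed.

(** A curved e_{i+1} gives s_i = s_{i+1} <= F_{n-i} < F_{n-i+1}. A straight one gives s_i = m_{i+1}
    + s_{i+1}, so both bounds at i+1 are attained. *)
Lemma run_maxP i : i.+2 < n -> run i = fib (n - i).+1 ->
  [/\ straight D i.+1, m i.+1 = fib (n - i.+1) & run i.+1 = fib (n - i.+1).+1].
Proof.
move=> ltin; have ltSin : i.+1 < n by lia.
have [m_gt0 _ mF rF] := mult_run_bounds ltSin.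
have eqF : fib (n - i).+1 = fib (n - i.+1).+1 + fib (n - i.+1).
  by rewrite -fibSS (subnSK (ltnW ltSin)).
have : 0 < fib (n - i.+1) by rewrite -(subnSK ltSin) fib_gt0.
have := fib_gt0 (n - i.+1); rewrite runS // multS //; case: ifP; case: ifP => *;
  split=> //; lia.
Qed.

(** * Constraints on the diagrams of E_n *)

Lemma decoration_eq (D' : decoration n) :
  (forall i, 0 < i < n -> straight D i = straight D' i) ->
  (forall i, i < n -> breaking D i = breaking D' i) -> D = D'.
Proof.
move=> sE bE; rewrite [D]surjective_pairing [D']surjective_pairing.
congr (_, _); apply/val_inj/(@eq_from_nth _ false); rewrite ?size_tuple // => i lti.
  have : 0 < i.+1 < n by lia.
  by move/sE; rewrite /straight.
Qed.

Lemma breaking_lt i : breaking D i -> i < n.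
Proof.
by case: (ltnP i n) => // le; rewrite /breaking nth_default ?size_tuple.
Qed.

Hypothesis DE : D \in enriques n.

Lemma straight1F : straight D 1 = false.
Proof. by move: DE; rewrite inE => /andP[/negPf]. Qed.

Lemma straight_last : straight D n.-1.
Proof. by move: DE; rewrite inE => /and3P[]. Qed.

Lemma breaking_straight i : breaking D i -> straight D i && straight D i.+1.
Proof.
move=> bi; move: DE; rewrite inE.
case/and5P=> _ _ _ _ /andP[_ /forallP/(_ (Ordinal (breaking_lt bi)))].
by move=> /implyP; apply.
Qed.

Lemma breaking_range i : breaking D i -> 1 < i < n.-1.
Proof.
move=> bi; have /andP[si sSi] := breaking_straight bi.
have := straight_lt sSi; case: i bi si sSi => [|[|i]] // bi si sSi; last by lia.
by rewrite straight1F in si.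
Qed.

Lemma n_gt2 : 2 < n.
Proof.
have := straight_lt straight_last; have := straight_last; have := straight1F.
move=> s1F sl ltn; apply: contraT => nn.
have [n0|n1] : n.-1 = 0 \/ n.-1 = 1 by lia.
  by rewrite n0 in sl.
by rewrite n1 s1F in sl.
Qed.

(** * Equality in the Fibonacci bounds *)

Lemma mult0E : m 0 = run 1.
Proof. by rewrite multS ?(ltnW n_gt2) // /inner straight1F. Qed.

Lemma breaking_mult_run i : (forall k, i < k < n.-1 -> breaking D k) -> i < n ->
  m i = fib (n - i) /\ run i = fib (n - i).+1.
Proof.
move=> + ltin; move: i ltin; apply: down_ind => [n_gt0 _|i ltSin IH bE].
  by rewrite mult_last ?run_last //; have -> : n - n.-1 = 1 by lia.
have [|mE rE] := IH; first by move=> k kE; apply: bE; lia.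
have eqF : fib (n - i).+1 = fib (n - i.+1).+1 + fib (n - i.+1).
  by rewrite -fibSS (subnSK (ltnW ltSin)).
have eqF' : fib (n - i) = fib (n - i.+1).+1 by rewrite (subnSK (ltnW ltSin)).
suff [sE iE] : straight D i.+1 /\ ~~ inner i.+1.
  by rewrite runS // multS // (negPf iE) sE; lia.
have [ltSi|] := ltnP i.+1 n.-1.
  have bi : breaking D i.+1 by apply: bE; rewrite leqnn.
  by have /andP[] := breaking_straight bi; rewrite /inner bi !andbF.
move=> le; have eqi : i.+1 = n.-1 by lia.
(* There is no edge e_n, so v_{n-1} is not [inner] and the third move applies there too. *)
rewrite eqi straight_last; split=> //; apply/negP => /and3P[_ /straight_lt]; lia.
Qed.

(** Maximality of s_i passes to (m_{i+1}, s_{i+1}). If v_{i+1} were neutral between straight edges,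
    m_i = m_{i+1} = F_{n-i-1} would fall short of F_{n-i}. *)
Lemma mult_run_max_breaking i : i < n ->
  m i = fib (n - i) -> run i = fib (n - i).+1 ->
  forall k, i < k < n.-1 -> breaking D k.
Proof.
move: i; apply: down_ind => [|i ltSin IH mE rE k kE]; first by lia.
have ltSSin : i.+2 < n by lia.
have [s1 m1 r1] := run_maxP ltSSin rE.
have bE := IH m1 r1.
have [ltSik|leki] := ltnP i.+1 k; first by apply: bE; lia.
have {leki} -> : k = i.+1 by lia.
have s2 : straight D i.+2.
  have [lt2|le2] := ltnP i.+2 n.-1.
    by have /andP[] := breaking_straight (bE i.+2 (introT andP (conj (leqnn _) lt2))).
  by have -> : i.+2 = n.-1; [lia | exact: straight_last].
apply: contraT => nb; move: mE; rewrite multS // /inner s1 s2 nb /= m1.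
rewrite -(subnSK (ltnW ltSin)) -(subnSK ltSin) fibSS.
by have := fib_gt0 (n - i.+2).-1; rewrite prednK; lia.
Qed.

(** * Lower bounds, attained when the edges are curved *)

Definition curved_from (i : nat) : bool :=
  all (fun k => ~~ straight D k) (index_iota i.+1 n.-1).

Lemma curved_fromS i : i.+1 < n.-1 ->
  curved_from i = ~~ straight D i.+1 && curved_from i.+1.
Proof. by move=> lti; rewrite /curved_from /index_iota -(subnSK lti). Qed.

(** The range of [curved_from] stops before e_{n-1}, which is straight in every diagram of E_n. *)
Lemma curved_from_last : curved_from n.-2.
Proof. by rewrite /curved_from /index_iota; have -> : n.-1 - n.-2.+1 = 0 by lia. Qed.

Lemma penultimate : m n.-2 = 1 /\ run n.-2 = 2.
Proof.
have n3 := n_gt2; have n0 : 0 < n by lia.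
have eqn : n.-2.+1 = n.-1 by lia.
have lt : n.-2.+1 < n by lia.
rewrite (runS lt) (multS lt) eqn straight_last (mult_last n0) (run_last n0).
by case: ifP.
Qed.

(** A curved edge keeps s, whereas a straight one adds m >= 1 to s >= 2 and destroys equality for
    good. *)
Lemma run_min i : i < n.-1 -> 2 <= run i ?= iff curved_from i.
Proof.
move: i; apply: down_ind => [_|i ltSi IH].
  by case: penultimate => _ ->; rewrite curved_from_last; split.
have ltSin : i.+1 < n by lia.
have [m_gt0 lemr _ _] := mult_run_bounds ltSin.
rewrite curved_fromS //; case: IH => r2 <-.
rewrite runS // multS // /inner; case: (straight D i.+1) => /=.
  by split; case: ifP; lia.
by rewrite addn0; split.
Qed.

Definition milnor_from (i : nat) : nat := \sum_(i <= k < n) m k * (m k - 1).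

(** At i = 1 the extra term s_1 (s_1 - 1) is the contribution of m_0 = s_1, so the left-hand bound
    becomes one on the Milnor number. *)
Lemma milnor_from_min i : i < n.-1 ->
  2 * (n.-1 - i) <= milnor_from i + run i * (run i - 1) ?= iff curved_from i.
Proof.
have n3 := n_gt2.
move: i; apply: down_ind => [_|i ltSi IH].
  have [mE ->] := penultimate; rewrite curved_from_last /milnor_from.
  have eqn : n.-2.+1 = n.-1 by lia.
  rewrite big_ltn; last by lia.
  rewrite eqn big_ltn; last by lia.
  rewrite big_geq; last by lia.
  rewrite mE mult_last; last by lia.
  by split; lia.
have ltSin : i.+1 < n by lia.
have [m_gt0 lemr _ _] := mult_run_bounds ltSin.
have [r2 r2E] := run_min ltSi.
have [V VE] := IH.
rewrite curved_fromS //.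
have -> : milnor_from i = m i * (m i - 1) + milnor_from i.+1.
  by rewrite {1}/milnor_from big_ltn // ltnW.
rewrite runS // multS //.
have -> : 2 * (n.-1 - i) = 2 + 2 * (n.-1 - i.+1) by lia.
move: r2E VE V; move: (milnor_from _) (curved_from _) => v c r2E VE V.
rewrite /inner; case: (straight D i.+1) => /=.
  (* With m >= 1 and s >= 2, a straight edge adds 2m(m-1) + 2ms or (s+m)(s+m-1), both larger than
     2. *)
  by case: ifP => _; split; nia.
rewrite addn0; move: (run i.+1) (2 * _) r2 r2E VE V {lemr} => r t r2 r2E VE V.
split; first by nia.
(* A curved edge adds s(s-1), which is 2 exactly when s = 2, that is, when the later edges up to
   e_{n-2} are curved. *)
case: c r2E VE => [/eqP <-|/eqP r2E VE]; first by move/eqP=> VE; lia.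
apply/negbTE; nia.
Qed.

Lemma milnorE : milnor D = run 1 * (run 1 - 1) + milnor_from 1.
Proof.
have n3 := n_gt2.
by rewrite /milnor -(big_mkord predT (fun k => m k * (m k - 1))) big_ltn ?mult0E //; lia.
Qed.

Lemma mult_min : 2 <= initial_mult D ?= iff curved_from 1.
Proof. by rewrite /initial_mult -/m mult0E; apply: run_min; have := n_gt2; lia. Qed.

Lemma milnor_min : 2 * n - 4 <= milnor D ?= iff curved_from 1.
Proof.
have n3 := n_gt2; have lt1 : 1 < n.-1 by lia.
have := milnor_from_min lt1; rewrite milnorE addnC.
by have -> : 2 * (n.-1 - 1) = 2 * n - 4 by lia.
Qed.

End Diagram.

(** * Decorations built from predicates *)

Section Decorate.
Variables (n : nat) (s b : pred nat).

Lemma straight_decorate i : straight (decorate n s b) i = (0 < i < n) && s i.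
Proof.
case: i => // i; rewrite /straight !ltn0Sn !andTb succnK /fst /decorate.
have [lti|lei] := ltnP i n.-1; last first.
  by rewrite nth_default ?size_tuple //; lia.
rewrite -[X in nth _ _ X]/(nat_of_ord (Ordinal lti)) -tnth_nth tnth_mktuple /=.
by have -> : i.+1 < n by lia.
Qed.

Lemma breaking_decorate i : breaking (decorate n s b) i = (i < n) && b i.
Proof.
rewrite /breaking /decorate.
have [lti|lei] := ltnP i n; last by rewrite nth_default ?size_tuple.
by rewrite -[i]/(nat_of_ord (Ordinal lti)) -tnth_nth tnth_mktuple.
Qed.

Lemma decorate_enriques : 2 < n -> ~~ s 1 -> s n.-1 ->
  (forall i, i < n -> b i -> [&& 1 < i < n.-1, s i & s i.+1]) ->
  decorate n s b \in enriques n.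
Proof.
move=> n3 s1 sn bE; have nb i : ~~ (1 < i < n.-1) -> ~~ breaking (decorate n s b) i.
  by rewrite breaking_decorate; apply: contra => /andP[lti /(bE _ lti)/andP[]].
rewrite inE !straight_decorate (negPf s1) sn !nb ?andbF //=; try lia.
apply/andP; split; first by lia.
apply/forallP=> i; rewrite breaking_decorate !straight_decorate.
apply/implyP=> /andP[lti /(bE _ lti)/and3P[iE -> ->]]; lia.
Qed.

End Decorate.

(** * The three extremal diagrams *)

Section Extremal.
Variables (n : nat) (n_ge3 : 2 < n).

Lemma alpha_enriques : alpha_diagram n \in enriques n.
Proof. by apply: decorate_enriques; rewrite ?eqxx //; lia. Qed.

Lemma omega_enriques : omega_diagram n \in enriques n.
Proof. by apply: decorate_enriques => // [|i]; lia. Qed.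

Lemma pi_enriques : pi_diagram n \in enriques n.
Proof. by apply: decorate_enriques => // [|i]; lia. Qed.

(** A breaking vertex needs straight edges on both sides, so curved edges e_2, ..., e_{n-2} leave
    only neutral vertices. *)
Lemma curved_alpha D : D \in enriques n -> curved_from D 1 = (D == alpha_diagram n).
Proof.
move=> DE; apply/allP/eqP => [cD|-> k]; last first.
  by rewrite mem_index_iota straight_decorate => kE; lia.
have nsD k : 1 < k < n.-1 -> ~~ straight D k.
  by move=> kE; apply: cD; rewrite mem_index_iota.
apply: decoration_eq => i iE; rewrite ?straight_decorate ?breaking_decorate ?andbF.
  have [->|ne] := eqVneq i n.-1; first by rewrite straight_last //; lia.
  have [->|ne1] := eqVneq i 1; first by rewrite straight1F ?andbF.
  by rewrite andbF; apply/negbTE/nsD; lia.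
apply/negbTE/negP=> bi; have /andP[si _] := breaking_straight DE bi.
by case/negP: (nsD _ (breaking_range DE bi)).
Qed.

Lemma breaking_omega D : D \in enriques n ->
  (forall k, 1 < k < n.-1 -> breaking D k) -> D = omega_diagram n.
Proof.
move=> DE bE; apply: decoration_eq => i iE; rewrite ?straight_decorate ?breaking_decorate.
  have [->|ne] := eqVneq i n.-1; first by rewrite straight_last //; lia.
  have [->|ne1] := eqVneq i 1; first by rewrite straight1F ?andbF.
  have iE' : 1 < i < n.-1 by lia.
  by have /andP[-> _] := breaking_straight DE (bE i iE'); lia.
rewrite iE; apply/idP/idP => [/(breaking_range DE)|/bE] //.
Qed.

Lemma breaking_pi D : D \in enriques n ->
  (forall k, 2 < k < n.-1 -> breaking D k) -> straight D 2 -> ~~ breaking D 2 ->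
  D = pi_diagram n.
Proof.
move=> DE bE s2 nb2.
apply: decoration_eq => i iE; rewrite ?straight_decorate ?breaking_decorate.
  have [->|ne] := eqVneq i n.-1; first by rewrite straight_last //; lia.
  have [->|ne1] := eqVneq i 1; first by rewrite straight1F ?andbF.
  have [->|ne2] := eqVneq i 2; first by rewrite s2; lia.
  have iE' : 2 < i < n.-1 by lia.
  by have /andP[-> _] := breaking_straight DE (bE i iE'); lia.
rewrite iE; apply/idP/idP => [bi|/bE //].
have := breaking_range DE bi; have [i2|] := eqVneq i 2; last by lia.
by rewrite i2 (negPf nb2) in bi.
Qed.

Lemma mult_omega i : i < n -> mult (omega_diagram n) i = fib (n - i).
Proof.
move=> ltin; have OE := omega_enriques.
have bE k : 1 < k < n.-1 -> breaking (omega_diagram n) k.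
  by rewrite breaking_decorate; lia.
(* The vertex v_1 is neutral, so the Fibonacci values hold by induction only from i = 1 on; then m_0
   = s_1 = F_n. *)
case: i ltin => [|i] ltin; last first.
  by have [|//] := breaking_mult_run (i := i.+1) OE _ ltin => k kE; apply: bE; lia.
have n_gt1 : 1 < n by lia.
by rewrite mult0E // (breaking_mult_run OE bE n_gt1).2 subn0 subn1 prednK.
Qed.

(** Whether v_2 is [inner] (n > 3) or not (n = 3), m_0 = s_1 = m_2 + s_2. *)
Lemma mult_pi : mult (pi_diagram n) 0 = fib n.
Proof.
have PE := pi_enriques; rewrite mult0E //.
have bE k : 2 < k < n.-1 -> breaking (pi_diagram n) k.
  by rewrite breaking_decorate; lia.
have [mE rE] := breaking_mult_run PE bE n_ge3.
rewrite (runS _ n_ge3) (multS _ n_ge3) mE rE straight_decorate n_ge3 andbT.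
have -> : fib n = fib (n - 2).+1 + fib (n - 2) by rewrite -fibSS -addn2 subnK // ltnW.
by case: (inner _ 2); first exact: addnC.
Qed.

(** Maximality of m_0 = s_1 makes e_2 straight and (m_2, s_2) maximal, hence v_3, ..., v_{n-2}
    breaking; only the choice at v_2 remains. *)
Lemma mult_max D : D \in enriques n ->
  initial_mult D <= fib n ?= iff (D \in [:: omega_diagram n; pi_diagram n]).
Proof.
move=> DE; have n_gt0 : 0 < n by lia.
have [_ _ le0 _] := mult_run_bounds D n_gt0; rewrite subn0 in le0.
split=> //; rewrite !inE; apply/eqP/orP => [|[] /eqP->]; last first.
- exact: mult_pi.
- by rewrite /initial_mult mult_omega ?subn0.
rewrite /initial_mult mult0E // => r1.
have [n3|n_gt3] : n = 3 \/ 3 < n by lia.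
  (* For n = 3 no index k satisfies 1 < k < n-1, so the breaking condition is vacuous. *)
  by left; apply/eqP/breaking_omega => // k; lia.
have r1' : run D 1 = fib (n - 1).+1 by rewrite r1; congr fib; lia.
have [s2 m2 r2] := run_maxP n_gt3 r1'.
have bE := mult_run_max_breaking DE n_ge3 m2 r2.
have [b2|nb2] := boolP (breaking D 2); last by right; apply/eqP/breaking_pi.
left; apply/eqP/breaking_omega => // k kE.
by have [->//|ne] := eqVneq k 2; apply: bE; lia.
Qed.

(** The comparison is termwise, since [omega_diagram] attains m_i = F_{n-i} for all i at once. *)
Lemma milnor_max D : D \in enriques n ->
  milnor D <= milnor (omega_diagram n) ?= iff (D == omega_diagram n).
Proof.
move=> DE; have [n_gt0 n_gt1] : 0 < n /\ 1 < n by lia.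
have leif (i : 'I_n) : true -> mult D i * (mult D i - 1)
    <= mult (omega_diagram n) i * (mult (omega_diagram n) i - 1)
    ?= iff (mult D i == fib (n - i)).
  have [m_gt0 _ mF _] := mult_run_bounds D (ltn_ord i).
  by move=> _; rewrite mult_omega //; exact: (leqif_pronic m_gt0 mF).
have [le eq] := leqif_sum leif; split=> //.
rewrite /milnor eq; apply/forallP/eqP => [mE|-> i]; last first.
  by rewrite mult_omega // eqxx.
(* The terms 0 and 1 suffice: they make s_1 = m_0 and m_1 maximal, which forces v_2, ..., v_{n-2} to
   be breaking. *)
have /eqP m0 := mE (Ordinal n_gt0); have /eqP m1 := mE (Ordinal n_gt1).
rewrite /= subn0 mult0E // in m0.
apply: breaking_omega => //; apply: mult_run_max_breaking => //.
by rewrite m0; congr fib; lia.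
Qed.

Lemma milnor_omega : milnor (omega_diagram n) = (fib n.+1 - 1) * (fib n - 1).
Proof.
rewrite /milnor; under eq_bigr => i _ do rewrite mult_omega //.
exact: sum_fib_pronic.
Qed.

End Extremal.

(** * From inequalities with equality cases to extremizers *)

Lemma minimizesP (n : nat) (f : decoration n -> nat) (c : nat) (D0 : decoration n) :
  D0 \in enriques n ->
  (forall D, D \in enriques n -> c <= f D ?= iff (D == D0)) ->
  f D0 = c /\ (forall D, minimizes f D <-> D = D0).
Proof.
move=> E0 cf; have f0 : f D0 = c by apply/esym/eqP; rewrite (cf _ E0).
split=> // D; split=> [[DE minD]|->].
  by apply/eqP; rewrite -(geq_leqif (cf D DE)) -f0 minD.
by split=> // D' D'E; rewrite f0 (cf _ D'E).
Qed.

(** Some member of the nonempty [s] attains c, so a maximizer has value c and lies in [s]. *)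
Lemma maximizesP (n : nat) (f : decoration n -> nat) (c : nat) (s : seq (decoration n)) :
  {subset s <= enriques n} -> s != [::] ->
  (forall D, D \in enriques n -> f D <= c ?= iff (D \in s)) ->
  forall D, maximizes f D <-> D \in s.
Proof.
move=> sE s_n0 cf D; split=> [[DE maxD]|Ds].
  rewrite -(geq_leqif (cf D DE)); case: s s_n0 sE cf => // D0 s _ sE cf.
  have D0s : D0 \in D0 :: s by rewrite mem_head.
  have /eqP <- : f D0 == c by rewrite (cf _ (sE _ D0s)).
  by apply: maxD; apply: sE.
have DE := sE _ Ds; split=> // D' D'E.
have /eqP -> : f D == c by rewrite (cf _ DE).
by rewrite (cf _ D'E).
Qed.

Theorem theorem5p2 (n : nat) (n_ge3 : 3 <= n) :
  (* (1) *)
  ((forall D : decoration n,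
      minimizes (@initial_mult n) D <-> D = alpha_diagram n) /\
   initial_mult (alpha_diagram n) = 2 /\
   (forall D : decoration n,
      minimizes (@milnor n) D <-> D = alpha_diagram n) /\
   milnor (alpha_diagram n) = 2 * n - 4) /\
  (* (2) *)
  ((forall D : decoration n,
      maximizes (@initial_mult n) D <->
        D = omega_diagram n \/ D = pi_diagram n) /\
   initial_mult (omega_diagram n) = fib n /\
   initial_mult (pi_diagram n) = fib n) /\
  (* (3) *)
  ((forall D : decoration n,
      maximizes (@milnor n) D <-> D = omega_diagram n) /\
   milnor (omega_diagram n) = (fib n.+1 - 1) * (fib n - 1)).
Proof.
have alphaE := alpha_enriques n_ge3.
have omegaE := omega_enriques n_ge3; have piE := pi_enriques n_ge3.
have [| multA minA] := minimizesP (f := @initial_mult n) (c := 2) alphaE.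
  by move=> D DE; rewrite -curved_alpha //; apply: mult_min.
have [| milnorA minMA] := minimizesP (f := @milnor n) (c := 2 * n - 4) alphaE.
  by move=> D DE; rewrite -curved_alpha //; apply: milnor_min.
split; first by [].
split; split.
- move=> D; have maxP :=
    maximizesP (s := [:: omega_diagram n; pi_diagram n]) _ _ (@mult_max n n_ge3).
  apply: (iff_trans (maxP _ _ D)) => [D'|//|].
    by rewrite in_cons mem_seq1 => /orP[] /eqP->.
  rewrite !inE; split=> [/orP[] /eqP ->|[] ->]; rewrite ?eqxx ?orbT; by [|left|right].
- by split; [rewrite /initial_mult mult_omega ?subn0 //; lia | apply: mult_pi].
- move=> D; have maxM D' : D' \in enriques n ->
      milnor D' <= milnor (omega_diagram n) ?= iff (D' \in [:: omega_diagram n]).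
    by move=> D'E; rewrite inE; apply: milnor_max.
  have maxP := maximizesP (s := [:: omega_diagram n]) _ _ maxM.
  apply: (iff_trans (maxP _ _ D)) => [D'|//|]; first by rewrite mem_seq1 => /eqP->.
  by rewrite inE; split=> /eqP.
- exact: milnor_omega.
Qed.
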